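(* Let $q,a,b$ be nonzero complex numbers with $|q|<1$ and $\max\{|ab|,|aq^2|,|bq^2|\}<1$. Then $$\frac{(q^2,ab;q^2)_\infty}{(aq^2,bq^2;q^2)_\infty}\;{}_3\phi_2\left(\begin{matrix}q^2/a,\,q^2/b,\,q^2\\ 0,\,q^3\end{matrix};q^2,ab\right)=(1-q)\sum_{n=0}^{\infty}(1+q^{2n+1})\frac{(q^2/a,q^2/b;q^2)_n}{(aq^2,bq^2;q^2)_n}(-ab)^nq^{3n^2+2n}\sum_{j=-n}^{n}q^{-2j^2-j}.$$
   Context: Notation, for a base $p$ with $|p|<1$: $(x;p)_0=1$, $(x;p)_n=\prod_{k=0}^{n-1}(1-xp^k)$, $(x;p)_\infty=\prod_{k=0}^\infty(1-xp^k)$, $(x_1,\dots,x_k;p)_n=(x_1;p)_n\cdots(x_k;p)_n$ (also for $n=\infty$), and $${}_3\phi_2\left(\begin{matrix}A_1,A_2,A_3\\ B_1,B_2\end{matrix};p,z\right)=\sum_{n=0}^\infty\frac{(A_1,A_2,A_3;p)_n}{(p,B_1,B_2;p)_n}z^n .$$ *)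

(* Defs.v *)
From HB Require Import structures.
From mathcomp Require Import all_boot all_order all_algebra.
From mathcomp Require Import all_classical all_reals all_analysis.
From mathcomp.real_closed Require Export complex.

Set Implicit Arguments.
Unset Strict Implicit.
Unset Printing Implicit Defensive.

Import Order.TTheory GRing.Theory Num.Theory numFieldNormedType.Exports.

Local Open Scope classical_set_scope.
Local Open Scope ring_scope.

(* The complex numbers are R[i] for R a model of the reals.  Neither library
   equips R[i] with a topology; this instance gives it the one induced by the
   modulus, as mathcomp-analysis does for every numFieldType K through K^o. *)
HB.instance Definition _ (R : realType) := NormedModule.copy R[i] R[i]^o.

Definition qpoch (R : realType) (x p : R[i]) (n : nat) : R[i] :=
  \prod_(k < n) (1 - x * p ^+ k).

(* As with any limn, this is meaningful only when the limit exists. *)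
Definition qpoch_inf (R : realType) (x p : R[i]) : R[i] :=
  limn (qpoch x p).

Definition phi32_term (R : realType) (A1 A2 A3 B1 B2 p z : R[i]) (n : nat) :
    R[i] :=
  (qpoch A1 p n * qpoch A2 p n * qpoch A3 p n)
  / (qpoch p p n * qpoch B1 p n * qpoch B2 p n) * z ^+ n.

Definition phi32 (R : realType) (A1 A2 A3 B1 B2 p z : R[i]) : R[i] :=
  limn (series (phi32_term A1 A2 A3 B1 B2 p z)).

(* The sum of F j over the integers j with - n <= j <= n. *)
Definition sym_sum (R : realType) (n : nat) (F : int -> R[i]) : R[i] :=
  \sum_(i < n.*2.+1) F (i%:Z - n%:Z).

Definition rhs_term (R : realType) (q a b : R[i]) (n : nat) : R[i] :=
  (1 + q ^+ (2 * n + 1))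
  * ((qpoch (q ^+ 2 / a) (q ^+ 2) n * qpoch (q ^+ 2 / b) (q ^+ 2) n)
     / (qpoch (a * q ^+ 2) (q ^+ 2) n * qpoch (b * q ^+ 2) (q ^+ 2) n))
  * (- (a * b)) ^+ n * q ^+ (3 * n ^ 2 + 2 * n)
  * sym_sum n (fun j => q ^ (- 2 * j ^+ 2 - j)).

(* Main.v *)
Require Import Defs.
From mathcomp Require Import all_boot all_order all_algebra.
From mathcomp Require Import all_classical all_reals all_analysis.
From mathcomp Require Import ring zify.

Set Implicit Arguments.
Unset Strict Implicit.
Unset Printing Implicit Defensive.

Import Order.TTheory GRing.Theory Num.Theory numFieldNormedType.Exports.

Local Open Scope classical_set_scope.
Local Open Scope ring_scope.

(* Bailey's lemma with base p = q^2, relative to p, with parameters p/a and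
   p/b, is applied to the Bailey pair whose beta_n is 1 / (q; q^2)_{n+1}.  The
   finite form of the lemma (a triangular change of summation followed by the
   q-Pfaff-Saalschutz sum) gives, for every N, an identity between two sums
   with N + 1 terms; both are dominated by a geometric series of ratio |ab|, so
   Tannery's theorem lets N tend to infinity.  The Saalschutz sum and the Bailey
   pair both follow from first-order recurrences proved by telescoping. *)

(** * Finite identities *)

Section QPochhammer.
Context {R : realType}.
Implicit Types x p c u v e : R[i].

Lemma qpoch0 x p : qpoch x p 0 = 1.
Proof. by rewrite /qpoch big_ord0. Qed.

Lemma qpochS x p n : qpoch x p n.+1 = qpoch x p n * (1 - x * p ^+ n).
Proof. by rewrite /qpoch big_ord_recr. Qed.

Lemma qpochD x p m n :
  qpoch x p (m + n) = qpoch x p m * qpoch (x * p ^+ m) p n.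
Proof.
elim: n => [|n IHn]; first by rewrite addn0 qpoch0 mulr1.
by rewrite addnS !qpochS IHn exprD !mulrA.
Qed.

(** For generic parameters this is [qpoch c p M / qpoch p p M] times the i-th term of the balanced
    series 3phi2(u, v, p^(-M); cuv, p^(1-M)/c; p, p). Leaving the two factors of length [M - i]
    unreversed avoids negative powers of p. *)
Definition saalschutz_term c u v p (M i : nat) : R[i] :=
  qpoch u p i * qpoch v p i * c ^+ i * qpoch c p (M - i)
  / (qpoch p p i * qpoch p p (M - i) * qpoch (c * u * v) p i).

(** * The q-Pfaff-Saalschutz sum *)

Section Saalschutz.
Variables (c u v p : R[i]).
Hypotheses (hp : forall n, qpoch p p n != 0)
  (he : forall n, qpoch (c * u * v) p n != 0).

Let hp1 n : 1 - p * p ^+ n != 0.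
Proof. by have := hp n.+1; rewrite qpochS mulf_eq0 negb_or => /andP[]. Qed.

Let he1 n : 1 - c * u * v * p ^+ n != 0.
Proof. by have := he n.+1; rewrite qpochS mulf_eq0 negb_or => /andP[]. Qed.

(* A q-WZ certificate: the summand is a difference in i of the right-hand side,
   so the sum over all i satisfies a first-order recurrence in M. *)
Lemma saalschutz_telescope M m : (m <= M)%N ->
  \sum_(i < m.+1) ((1 - p * p ^+ M) * (1 - c * u * v * p ^+ M)
                     * saalschutz_term c u v p M.+1 i
                   - (1 - c * v * p ^+ M) * (1 - c * u * p ^+ M)
                     * saalschutz_term c u v p M i) =
  - (p ^+ (M - m) * qpoch u p m.+1 * qpoch v p m.+1 * c ^+ m.+1
     * qpoch c p (M - m))
  / (qpoch p p m * qpoch p p (M - m) * qpoch (c * u * v) p m).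
Proof.
elim: m => [_|m IHm lt_mM].
  rewrite big_ord1 /saalschutz_term !subn0 !qpochS !qpoch0 !expr0 !expr1.
  field.
  by rewrite hp hp1.
rewrite big_ord_recr IHm 1?ltnW//= /saalschutz_term.
have -> : (M.+1 - m.+1 = (M - m.+1).+1)%N by rewrite subSn.
have -> : (M - m = (M - m.+1).+1)%N by rewrite subnSK.
(* With k = M - m - 1, the powers p^m and p^k become independent variables, and the step is a
   rational identity. *)
have : p ^+ M = p * p ^+ m * p ^+ (M - m.+1) by rewrite -exprS -exprD subnKC.
move: (M - m.+1)%N => k ->.
rewrite !(qpochS _ _ m.+1) !(qpochS _ _ m) !(qpochS _ _ k) !exprS.
have := hp m; have := hp k; have := he m.
have := hp1 m; have := hp1 k; have := he1 m.
move: (qpoch p p m) (qpoch p p k) (qpoch (c * u * v) p m).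
move=> P K E; move: (qpoch u p m) (qpoch v p m) (qpoch c p k) => U V C.
move: (p ^+ m) (p ^+ k) (c ^+ m) => pm pk cm.
move=> he1m hp1k hp1m hem hpk hpm; field.
by rewrite he1m hem hpk hp1m hpm hp1k.
Qed.

Lemma q_saalschutz M :
  \sum_(i < M.+1) saalschutz_term c u v p M i =
  qpoch (c * v) p M * qpoch (c * u) p M / (qpoch p p M * qpoch (c * u * v) p M).
Proof.
elim: M => [|M IHM].
  by rewrite big_ord1 /saalschutz_term !qpoch0 !expr0 !mulr1.
have := saalschutz_telescope (leqnn M).
rewrite sumrB -!mulr_sumr IHM => /eqP; rewrite subr_eq => /eqP E.
have {}E : \sum_(i < M.+1) saalschutz_term c u v p M.+1 i =
  (- (qpoch u p M.+1 * qpoch v p M.+1 * c ^+ M.+1)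
   / (qpoch p p M * qpoch (c * u * v) p M)
  + (1 - c * v * p ^+ M) * (1 - c * u * p ^+ M) *
   (qpoch (c * v) p M * qpoch (c * u) p M
    / (qpoch p p M * qpoch (c * u * v) p M)))
   / ((1 - p * p ^+ M) * (1 - c * u * v * p ^+ M)).
  apply: (canRL (mulfK _)); first by rewrite mulf_neq0.
  by rewrite mulrC E subnn !qpoch0 expr0 !mulr1 !mul1r.
(* The sum for M + 1 has one term beyond the telescoped range, i = M + 1; it cancels the boundary
   term in [E]. *)
rewrite big_ord_recr /= E /saalschutz_term subnn !qpochS !qpoch0.
field.
by rewrite hp he hp1 he1.
Qed.

End Saalschutz.

Lemma sym_sumS n (F : int -> R[i]) :
  sym_sum n.+1 F = sym_sum n F + F n.+1%:Z + F (- n.+1%:Z).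
Proof.
rewrite /sym_sum doubleS big_ord_recl big_ord_recr /= [LHS]addrC sub0r.
congr (_ + _ + _); last by rewrite /bump; congr F; lia.
by apply: eq_bigr => i _; rewrite /bump; congr F; lia.
Qed.

(* Up to a constant factor this is the alpha_r of a Bailey pair relative to q^2
   in base q^2; the factor turns (q^4; q^2)_{n+r} into (q^2; q^2)_{n+r+1} in
   bailey_term and makes beta_n = 1 / (q; q^2)_{n+1}. *)
Definition bailey_alpha q r : R[i] :=
  (1 + q ^+ (2 * r + 1)) * (-1) ^+ r * q ^+ (3 * r ^ 2 + 2 * r)
  * sym_sum r (fun j => q ^ (- 2 * j ^+ 2 - j)).

Definition bailey_term q n r : R[i] :=
  bailey_alpha q r
  / (qpoch (q ^+ 2) (q ^+ 2) (n - r) * qpoch (q ^+ 2) (q ^+ 2) (n + r).+1).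

(** * The Bailey pair *)

Section BaileyPair.
Variable q : R[i].
Hypotheses (q0 : q != 0) (hp : forall n, qpoch (q ^+ 2) (q ^+ 2) n != 0)
  (hq : forall n, qpoch q (q ^+ 2) n != 0).
Let A n := sym_sum n (fun j => q ^ (- 2 * j ^+ 2 - j)).

Let hp1 n : 1 - q ^+ 2 * (q ^+ 2) ^+ n != 0.
Proof. by have := hp n.+1; rewrite qpochS mulf_eq0 negb_or => /andP[]. Qed.

Let A0 : A 0 = 1.
Proof. by rewrite /A /sym_sum big_ord1. Qed.

(** The new indices n + 1 and -(n + 1) have exponents that differ by 2n + 2, whence the common
    factor. It is split into powers of [q ^+ n] and [q ^+ (n ^ 2)], which later serve as independent
    variables. *)
Let AS n : A n.+1 = A n + (1 + q ^+ (2 * n + 2))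
  / (q ^+ (n ^ 2)) ^+ 2 / (q ^+ n) ^+ 5 / q ^+ 3.
Proof.
rewrite /A sym_sumS -addrA; congr (_ + _).
have -> : - 2 * (n.+1%:Z) ^+ 2 - n.+1%:Z = - (2 * n ^ 2 + 5 * n + 3)%N%:Z
  by nia.
have -> : - 2 * (- n.+1%:Z) ^+ 2 - - n.+1%:Z =
  - (2 * n ^ 2 + 5 * n + 3)%N%:Z + (2 * n + 2)%N%:Z by nia.
rewrite expfzDr // -exprnN -exprnP.
have -> : q ^+ (2 * n ^ 2 + 5 * n + 3) = (q ^+ (n ^ 2)) ^+ 2
  * (q ^+ n) ^+ 5 * q ^+ 3.
  by rewrite 2!exprD (mulnC 2) (mulnC 5) exprM (exprM _ n 5).
have := expf_neq0 n q0; have := expf_neq0 (n ^ 2) q0.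
move: (q ^+ n) (q ^+ (n ^ 2)) (q ^+ (2 * n + 2)) => Q S T S0 Q0.
field.
by rewrite q0 S0 Q0.
Qed.

(** The factor 1 - q^(2n+3) is (q; q^2)_{n+2} / (q; q^2)_{n+1}, the ratio wanted between consecutive
    sums. Since alpha_r contains [A r], the certificate has a part linear in [A m] and a part free
    of it; the latter absorbs the increment given by [AS]. *)
Lemma bailey_telescope n m : (m <= n)%N ->
  \sum_(0 <= r < m.+1) ((1 - q * (q ^+ 2) ^+ n.+1) * bailey_term q n.+1 r
                   - bailey_term q n r) =
  (-1) ^+ m * (q ^+ 2) ^+ n.+1
  * (q ^+ (3 * m.+1 ^ 2) * A m
     + q ^+ (m ^ 2 + m) * (1 - q ^+ 2 * (q ^+ 2) ^+ (n + m).+1)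
       / (1 - (q ^+ 2) ^+ n.+1))
  / (qpoch (q ^+ 2) (q ^+ 2) (n - m) * qpoch (q ^+ 2) (q ^+ 2) (n + m).+2).
Proof.
elim: m => [_|m IHm lt_mn].
  rewrite big_nat1 /bailey_term /bailey_alpha -/(A 0) A0 !subn0 !addn0.
  rewrite !qpochS !expr0 !expr1 (exprS _ n).
  have := hp n; have := hp1 n; have := hp1 n.+1; rewrite (exprS _ n).
  move: (qpoch _ _ n) ((q ^+ 2) ^+ n) => P Q h1 h2 h3.
  by field; rewrite h1 h2 h3.
rewrite big_nat_recr //= IHm 1?ltnW // /bailey_term /bailey_alpha -/(A m.+1).
rewrite AS subSS.
have -> : (n - m = (n - m.+1).+1)%N by rewrite subnSK.
rewrite (_ : n.+1 + m.+1 = (n + m).+2)%N; last by rewrite addSn addnS.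
rewrite (_ : n + m.+1 = (n + m).+1)%N; last by rewrite addnS.
(* Every power is turned into a monomial in q, q^m, q^(m^2) and (q^2)^(n-m-1); generalizing the last
   three leaves a rational identity. *)
have eP0 : (q ^+ 2) ^+ n.+1 = q ^+ 4 * (q ^+ m) ^+ 2 * (q ^+ 2) ^+ (n - m.+1).
  by rewrite -!exprM -!exprD; congr (_ ^+ _); lia.
have eP1 : (q ^+ 2) ^+ (n + m).+1 = q ^+ 4 * (q ^+ m) ^+ 4
  * (q ^+ 2) ^+ (n - m.+1).
  by rewrite -!exprM -!exprD; congr (_ ^+ _); lia.
have eP2 : (q ^+ 2) ^+ (n + m).+2 = q ^+ 6 * (q ^+ m) ^+ 4
  * (q ^+ 2) ^+ (n - m.+1).
  by rewrite -!exprM -!exprD; congr (_ ^+ _); lia.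
have e1 : q ^+ (3 * m.+1 ^ 2 + 2 * m.+1) = (q ^+ (m ^ 2)) ^+ 3
  * (q ^+ m) ^+ 8 * q ^+ 5.
  by rewrite -!exprM -!exprD; congr (_ ^+ _); nia.
have e2 : q ^+ (3 * m.+1 ^ 2) = (q ^+ (m ^ 2)) ^+ 3 * (q ^+ m) ^+ 6 * q ^+ 3.
  by rewrite -!exprM -!exprD; congr (_ ^+ _); nia.
have e3 : q ^+ (3 * m.+2 ^ 2) = (q ^+ (m ^ 2)) ^+ 3 * (q ^+ m) ^+ 12 * q ^+ 12.
  by rewrite -!exprM -!exprD; congr (_ ^+ _); nia.
have e4 : q ^+ (m ^ 2 + m) = q ^+ (m ^ 2) * q ^+ m by rewrite exprD.
have e5 : q ^+ (m.+1 ^ 2 + m.+1) = q ^+ (m ^ 2) * (q ^+ m) ^+ 3 * q ^+ 2.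
  by rewrite -!exprM -!exprD; congr (_ ^+ _); nia.
have e6 : q ^+ (2 * m.+1 + 1) = (q ^+ m) ^+ 2 * q ^+ 3.
  by rewrite -!exprM -!exprD; congr (_ ^+ _); nia.
have e7 : q ^+ (2 * m + 2) = (q ^+ m) ^+ 2 * q ^+ 2.
  by rewrite -!exprM -!exprD; congr (_ ^+ _); nia.
rewrite e1 e2 e3 e4 e5 e6 e7 !(qpochS _ _ (n + m).+2) !(qpochS _ _ (n - m.+1)).
rewrite eP0 eP1 eP2 (exprS (-1)).
have := hp1 (n + m).+2; have := hp1 (n + m).+1; have := hp1 (n - m.+1).
have := hp1 n; rewrite -exprS eP0 eP1 eP2.
have := hp (n + m).+2; have := hp (n - m.+1).
have := expf_neq0 (m ^ 2) q0; have := expf_neq0 m q0.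
move: (qpoch _ _ (n + m).+2) (qpoch _ _ (n - m.+1)) (A m) => T P a.
move: (q ^+ m) (q ^+ (m ^ 2)) ((q ^+ 2) ^+ (n - m.+1)) ((-1) ^+ m) => Q S K s.
move=> hQ hS hP hT h1 h2 h3 h4.
field.
by rewrite h4 hT hP h1 q0 hQ hS h2.
Qed.

Let hq1 n : 1 - q * (q ^+ 2) ^+ n != 0.
Proof. by have := hq n.+1; rewrite qpochS mulf_eq0 negb_or => /andP[]. Qed.

(** At m = n only the top term r = n + 1 is missing, and it cancels the certificate: the quotient
    there is (1 - q^(4n+4)) / (1 - q^(2n+2)) = 1 + q^(2n+2), the factor in [AS]. *)
Lemma bailey_telescope_last n :
  (1 - q * (q ^+ 2) ^+ n.+1) * (\sum_(0 <= r < n.+2) bailey_term q n.+1 r) =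
  \sum_(0 <= r < n.+1) bailey_term q n r.
Proof.
have := bailey_telescope (leqnn n).
rewrite sumrB -mulr_sumr => /eqP; rewrite subr_eq => /eqP E.
rewrite big_nat_recr //= mulrDr {}E addrAC -[RHS]add0r; congr (_ + _).
rewrite /bailey_term /bailey_alpha -/(A n.+1) AS.
rewrite !subnn qpoch0 (_ : n.+1 + n.+1 = (n + n).+2)%N;
  last by rewrite addSn addnS.
have eP0 : (q ^+ 2) ^+ n.+1 = q ^+ 2 * (q ^+ n) ^+ 2.
  by rewrite -!exprM -!exprD; congr (_ ^+ _); lia.
have eP1 : (q ^+ 2) ^+ (n + n).+1 = q ^+ 2 * (q ^+ n) ^+ 4.
  by rewrite -!exprM -!exprD; congr (_ ^+ _); lia.
have eP2 : (q ^+ 2) ^+ (n + n).+2 = q ^+ 4 * (q ^+ n) ^+ 4.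
  by rewrite -!exprM -!exprD; congr (_ ^+ _); lia.
have e1 : q ^+ (3 * n.+1 ^ 2 + 2 * n.+1) = (q ^+ (n ^ 2)) ^+ 3
  * (q ^+ n) ^+ 8 * q ^+ 5.
  by rewrite -!exprM -!exprD; congr (_ ^+ _); nia.
have e2 : q ^+ (3 * n.+1 ^ 2) = (q ^+ (n ^ 2)) ^+ 3 * (q ^+ n) ^+ 6 * q ^+ 3.
  by rewrite -!exprM -!exprD; congr (_ ^+ _); nia.
have e4 : q ^+ (n ^ 2 + n) = q ^+ (n ^ 2) * q ^+ n by rewrite exprD.
have e6 : q ^+ (2 * n.+1 + 1) = (q ^+ n) ^+ 2 * q ^+ 3.
  by rewrite -!exprM -!exprD; congr (_ ^+ _); nia.
have e7 : q ^+ (2 * n + 2) = (q ^+ n) ^+ 2 * q ^+ 2.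
  by rewrite -!exprM -!exprD; congr (_ ^+ _); nia.
rewrite e1 e2 e4 e6 e7 (qpochS _ _ (n + n).+2) eP0 eP1 eP2 (exprS (-1)).
have := hp1 (n + n).+2.
have := hp1 n; rewrite -exprS eP0 eP2.
have := hp (n + n).+2.
have := expf_neq0 (n ^ 2) q0; have := expf_neq0 n q0.
move: (qpoch _ _ (n + n).+2) (A n) => T a.
move: (q ^+ n) (q ^+ (n ^ 2)) ((-1) ^+ n) => Q S s.
move=> hQ hS hT h1 h4.
field.
by rewrite !exprMn h4 hT h1 q0 hQ hS.
Qed.

Lemma bailey_pair n :
  \sum_(0 <= r < n.+1) bailey_term q n r = (qpoch q (q ^+ 2) n.+1)^-1.
Proof.
elim: n => [|n IHn].
  rewrite big_nat1 /bailey_term /bailey_alpha -/(A 0) A0 !qpochS !qpoch0 !expr0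
    !expr1.
  have := hp1 0; have := hq1 0; rewrite !expr0 !mulr1 => h1 h2.
  by field; rewrite h1 h2.
rewrite qpochS -(mulKf (hq1 n.+1) (\sum_(0 <= r < _) _)).
by rewrite bailey_telescope_last IHn invfM mulrC.
Qed.
End BaileyPair.

(** * The finite Bailey lemma *)

Lemma triangular_sum (V : nmodType) (F : nat -> nat -> V) n :
  \sum_(0 <= j < n) \sum_(0 <= r < j.+1) F j r =
  \sum_(0 <= r < n) \sum_(0 <= i < n - r) F (r + i)%N r.
Proof.
elim: n => [|n IHn]; first by rewrite !big_nil.
rewrite big_nat_recr //= IHn [RHS]big_nat_recr //= subSnn big_nat1 addn0.
rewrite [X in _ + X]big_nat_recr //= addrA -big_split /=; congr (_ + _).
rewrite !big_nat; apply: eq_bigr => r /andP[_ lt_rn].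
by rewrite subSn ?(ltnW lt_rn)// big_nat_recr //= subnKC // ltnW.
Qed.

(** After the interchange of sums put j = r + i. Then (p; p)_{2r+1+i} = (p; p)_{2r+1} (p^(2r+2);
    p)_i, and by cuv = p^2 the parameter p^(2r+2) is the lower one of the Saalschutz sum for u p^r,
    v p^r and c. So the inner sum over i is [q_saalschutz] with M = N - r. *)
Lemma bailey_lemma (alpha : nat -> R[i]) (u v c p : R[i]) N :
    c * u * v = p ^+ 2 -> (forall n, qpoch p p n != 0) ->
    (forall n, qpoch (c * u) p n != 0) -> (forall n, qpoch (c * v) p n != 0) ->
  \sum_(0 <= j < N.+1) qpoch u p j * qpoch v p j * c ^+ j
    * (qpoch c p (N - j) / qpoch p p (N - j))
    * (\sum_(0 <= r < j.+1)
         alpha r / (qpoch p p (j - r) * qpoch p p (j + r).+1)) =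
  \sum_(0 <= r < N.+1) alpha r * (qpoch u p r * qpoch v p r * c ^+ r)
    * (qpoch (c * u) p N * qpoch (c * v) p N)
    / (qpoch (c * u) p r * qpoch (c * v) p r
       * (qpoch p p (N - r) * qpoch p p (N + r).+1)).
Proof.
move=> cuv hp hcu hcv.
under eq_bigr => j _ do rewrite mulr_sumr.
rewrite triangular_sum !big_nat; apply: eq_bigr => r /andP[_];
  rewrite ltnS => le_rN.
rewrite subSn //.
have -> : (N + r).+1 = ((r + r).+1 + (N - r))%N by lia.
have qN x : qpoch x p N = qpoch x p r * qpoch (x * p ^+ r) p (N - r).
  by rewrite -qpochD subnKC.
set M := (N - r)%N in qN *.
have e : c * (u * p ^+ r) * (v * p ^+ r) = p * p ^+ (r + r).+1.
  rewrite -exprS (_ : (r + r).+2 = 2 + r + r)%N; last by lia.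
  by rewrite !exprD -cuv; ring.
have he n : qpoch (p * p ^+ (r + r).+1) p n != 0.
  by have := hp ((r + r).+1 + n)%N; rewrite qpochD mulf_eq0 negb_or => /andP[].
have := @q_saalschutz c (u * p ^+ r) (v * p ^+ r) p hp;
  rewrite e => /(_ he M) E.
transitivity (alpha r * (qpoch u p r * qpoch v p r * c ^+ r)
  / qpoch p p (r + r).+1
   * \sum_(i < M.+1) saalschutz_term c (u * p ^+ r) (v * p ^+ r) p M i).
  rewrite mulr_sumr big_mkord; apply: eq_bigr => i _.
  rewrite /saalschutz_term e.
  rewrite addKn (_ : N - (r + i) = M - i)%N; last by rewrite /M subnDA.
  rewrite (_ : (r + i + r).+1 = (r + r).+1 + i)%N; last by lia.
  rewrite !(qpochD _ _ r) (qpochD _ _ (r + r).+1) exprD.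
  field.
  by rewrite !hp he.
rewrite E !qN (qpochD _ _ (r + r).+1) !mulrA.
field.
by rewrite !hp hcu hcv he.
Qed.

End QPochhammer.

(** * Sequences of complex numbers *)

Local Open Scope complex_scope.
Local Notation Re := complex.Re.
Local Notation Im := complex.Im.

Section ComplexSequences.
Context {R : realType}.
Implicit Types (u : nat -> R[i]) (r C : R[i]).

Lemma normc_realE (x : R) : `|x%:C| = `|x|%:C.
Proof. by rewrite normc_def /= expr0n addr0 sqrtr_sqr. Qed.

Lemma normc_ge_Im (x : R[i]) : `|Im x|%:C <= `|x|.
Proof.
have -> : `|x| = `|x * 'i%C| by rewrite normrM complexiE normCi mulr1.
by apply: le_trans (normc_ge_Re _); rewrite ReiNIm normrN.
Qed.

Lemma Re_normK (x : R[i]) : (Re `|x|)%:C = `|x|.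
Proof. exact/RRe_real/normr_real. Qed.

Lemma cvg_real_complex (f : nat -> R) (l : R) :
  f @ \oo --> l -> (fun n => (f n)%:C) @ \oo --> l%:C.
Proof.
move=> /cvgrPdist_lt fl; apply/cvgrPdist_lt => e e0.
(* In the partial order of [R[i]], 0 < e forces e to be real, so it comes from a real tolerance. *)
have eE : (Re (e : R[i]))%:C = e by apply: RRe_real; exact: gtr0_real.
have : 0 < Re (e : R[i]) by rewrite -ltcR eE.
move=> /fl; apply: filterS => n.
by rewrite -rmorphB normc_realE -eE ltcR.
Qed.

Lemma cvg_complex u (a b : R) :
    (fun n => Re (u n)) @ \oo --> a -> (fun n => Im (u n)) @ \oo --> b ->
  u @ \oo --> a%:C + 'i%C * b%:C.
Proof.
move=> ua ub.
rewrite (_ : u = fun n => (Re (u n))%:C + 'i%C * (Im (u n))%:C); last first.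
  by apply/funext => n; exact: complexE.
apply: cvgD; first exact: cvg_real_complex.
by apply: cvgM; [exact: cvg_cst|exact: cvg_real_complex].
Qed.

Lemma geometric_sum_le (K : numFieldType) (x : K) n : 0 <= x < 1 ->
  \sum_(0 <= k < n) x ^+ k <= (1 - x)^-1.
Proof.
move=> /andP[x0 x1].
have -> : \sum_(0 <= k < n) x ^+ k = (1 - x ^+ n) / (1 - x).
  have /(congr1 (@^~ n)) := geometric_seriesE 1 (negbT (lt_eqF x1)).
  rewrite /series /= /geometric; under eq_bigr do rewrite /= mul1r.
  by rewrite mul1r.
apply: ler_piMl; first by rewrite invr_ge0 subr_ge0 ltW.
by rewrite lerBlDr lerDl exprn_ge0.
Qed.

(** Real and imaginary parts are dominated by the same geometric series, so each converges
    absolutely over the reals; [cvg_complex] recombines the limits. *)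
Lemma geometric_cvgn u C r : `|r| < 1 -> (forall n, `|u n| <= C * `|r| ^+ n) ->
  cvgn (series u).
Proof.
move=> r1 uC.
have C0 : 0 <= C.
  by have := uC 0; rewrite expr0 mulr1; exact: le_trans.
pose c := Re C; pose x := Re `|r|.
have cE : c%:C = C by apply: RRe_real; exact: ger0_real.
have xE : x%:C = `|r| by exact: Re_normK.
have x1 : `|x| < 1 by rewrite -ltcR -normc_realE xE normr_id.
have c0 : 0 <= c by rewrite -ler0c cE.
have x0 : 0 <= x by rewrite -ler0c xE.
have key (v : nat -> R) : (forall n, `|v n|%:C <= `|u n|) -> cvgn (series v).
  move=> vu; apply: normed_cvg; apply: (series_le_cvg _ _ _
    (is_cvg_geometric_series x1 (a := c))).
  - by move=> n /=.
  - by move=> n; rewrite geometric_ge0.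
  - move=> n; rewrite /geometric /= -lecR (le_trans (vu _))//.
    by rewrite (le_trans (uC _))// rmorphM rmorphXn /= cE xE.
have /cvg_ex[/= a ha] : cvgn (series (fun n => Re (u n))).
  by apply: key => n; exact: normc_ge_Re.
have /cvg_ex[/= b hb] : cvgn (series (fun n => Im (u n))).
  by apply: key => n; exact: normc_ge_Im.
have ReD (z w : R[i]) : Re (z + w) = Re z + Re w by case: z; case: w.
have ImD (z w : R[i]) : Im (z + w) = Im z + Im w by case: z; case: w.
apply/cvg_ex; exists (a%:C + 'i%C * b%:C); apply: cvg_complex.
  rewrite (_ : (fun n => _) = series (fun n => Re (u n)))//.
  by apply/funext => n; rewrite /series /= (big_morph _ ReD erefl).
rewrite (_ : (fun n => _) = series (fun n => Im (u n)))//.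
by apply/funext => n; rewrite /series /= (big_morph _ ImD erefl).
Qed.

Lemma cvg_to_norm_le u (l : R[i]) C :
  u @ \oo --> l -> (forall n, `|u n| <= C) -> `|l| <= C.
Proof.
(* C bounds a modulus and is therefore real; only then does the failure of |l| <= C give C < |l|. *)
move=> ul uC; have CR : C \is Num.real.
  by rewrite -(ger0_norm (le_trans (normr_ge0 _) (uC 0))) normr_real.
rewrite real_leNgt ?normr_real//; apply/negP => lC.
have [N _ /(_ N (leqnn N))] := cvgr_norm_gt _ ul _ lC.
by move=> /= h; have := lt_le_trans h (uC N); rewrite ltxx.
Qed.

Lemma cvg_sum_nat (f : nat -> nat -> R[i]) (g : nat -> R[i]) n :
  (forall j, f^~ j @ \oo --> g j) ->
  (fun N => \sum_(0 <= j < n) f N j) @ \oo --> \sum_(0 <= j < n) g j.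
Proof. by move=> fg; apply: cvg_big => // -[x y]; exact: add_continuous. Qed.

Lemma cvg_normc_expr r : `|r| < 1 -> (fun n => `|r| ^+ n) @ \oo --> (0 : R[i]).
Proof.
move=> r1; have : `|Re `|r| | < 1
  by rewrite -ltcR -normc_realE Re_normK normr_id.
move=> /cvg_expr /cvg_real_complex;
  rewrite (_ : (fun n => _) = (fun n => `|r| ^+ n))//.
by apply/funext => n; rewrite rmorphXn /= Re_normK.
Qed.

(** Cut at J with C |r|^J / (1 - |r|) < e / 2, which bounds the tail uniformly in N; the J remaining
    terms form a fixed finite sum tending to 0. *)
Lemma dominated_series_cvg0 (d : nat -> nat -> R[i]) C r :
    `|r| < 1 -> (forall N j, `|d N j| <= C * `|r| ^+ j) ->
    (forall j, d^~ j @ \oo --> (0 : R[i])) ->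
  (fun N => \sum_(0 <= j < N) d N j) @ \oo --> (0 : R[i]).
Proof.
move=> r1 dC d0; apply/cvgr0Pnorm_lt => e e0.
have C0 : 0 <= C.
  by have := dC 0 0; rewrite expr0 mulr1; exact: le_trans.
have e20 : 0 < e / 2 by rewrite divr_gt0.
have tail0 : (fun J => C / (1 - `|r|) * `|r| ^+ J) @ \oo --> (0 : R[i]).
  rewrite -(mulr0 (C / (1 - `|r|))).
  by apply: cvgM; [exact: cvg_cst|exact: cvg_normc_expr].
have /cvgr0Pnorm_lt/(_ _ e20)[J _ /(_ J (leqnn J)) tailJ] := tail0.
have head0 := @cvg_sum_nat d (fun=> 0) J d0; rewrite big1 // in head0.
have /cvgr0Pnorm_lt/(_ _ e20) := head0.
apply: filterS2 (nbhs_infty_ge J) => N /= le_JN headN.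
rewrite (big_cat_nat _ le_JN) //=.
rewrite (le_lt_trans (ler_normD _ _))// [e]splitr ltrD//
  (le_lt_trans _ tailJ)//.
rewrite [leRHS]ger0_norm; last first.
  by rewrite mulr_ge0 ?exprn_ge0 ?divr_ge0 ?subr_ge0 ?(ltW r1).
rewrite (le_trans (ler_norm_sum _ _ _))//.
rewrite (le_trans (ler_sum _ (fun j _ => dC N j)))// -mulr_sumr.
rewrite -mulrA ler_wpM2l// -{1}(subnKC le_JN) geometric_partial_tail /series /=.
rewrite mulrC /geometric /= -mulr_sumr ler_wpM2l ?exprn_ge0//.
by rewrite geometric_sum_le ?normr_ge0.
Qed.

Lemma tannery (f : nat -> nat -> R[i]) g C r :
    `|r| < 1 -> (forall N j, `|f N j| <= C * `|r| ^+ j) ->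
    (forall j, f^~ j @ \oo --> g j) ->
  cvgn (series g) /\
  (fun N => \sum_(0 <= j < N.+1) f N j) @ \oo --> limn (series g).
Proof.
move=> r1 fC fg.
have gC j : `|g j| <= C * `|r| ^+ j by exact: cvg_to_norm_le (fg j) (fC^~ j).
have cg : cvgn (series g) by exact: geometric_cvgn r1 gC.
split=> //.
(* The shift matches the N + 1 terms of [f N] with the N terms allowed in [dominated_series_cvg0];
   the default value 0 at N = 0 satisfies the bound too. *)
pose d N j := if N is M.+1 then f M j - g j else 0.
have C0 : 0 <= C.
  by have := fC 0 0; rewrite expr0 mulr1; exact: le_trans.
have : (fun N => \sum_(0 <= j < N) d N j) @ \oo --> (0 : R[i]).
  apply: (@dominated_series_cvg0 d (C + C) r r1) => [N j|j].
    case: N => [|N] /=; first by rewrite normr0 mulr_ge0 ?addr_ge0 ?exprn_ge0.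
    by rewrite mulrDl (le_trans (ler_normB _ _))// lerD.
  have dj : (fun N => f N j - g j) @ \oo --> (0 : R[i]).
    by rewrite -(subrr (g j)); apply: cvgB; [exact: fg|exact: cvg_cst].
  rewrite -(cvg_shiftS (d^~ j)); exact: dj.
rewrite -cvg_shiftS => d0.
have -> : (fun N => \sum_(0 <= j < N.+1) f N j) =
    (fun N => \sum_(0 <= j < N.+1) d N.+1 j + series g N.+1).
  apply/funext => N; rewrite /series /= -big_split /=.
  by apply: eq_bigr => j _; rewrite subrK.
rewrite -[limn (series g)]add0r.
apply: cvgD; first exact: d0.
by rewrite (cvg_shiftS (series g)).
Qed.

(** The form taken by both sides of the finite identity: t carries the geometric decay, while the
    weights w are bounded and have a limit l that does not depend on j. *)
Lemma weighted_tannery (t : nat -> R[i]) (w : nat -> nat -> R[i]) l C D r :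
    `|r| < 1 -> (forall j, `|t j| <= C * `|r| ^+ j) ->
    (forall N j, `|w N j| <= D) -> (forall j, w^~ j @ \oo --> l) ->
  (fun N => \sum_(0 <= j < N.+1) t j * w N j) @ \oo --> limn (series t) * l.
Proof.
move=> r1 tC wD wl.
have ct : cvgn (series t) by exact: geometric_cvgn tC.
have [_] : cvgn (series (fun j => t j * l)) /\
    (fun N => \sum_(0 <= j < N.+1) t j * w N j) @ \oo -->
    limn (series (fun j => t j * l)).
  apply: (@tannery (fun N j => t j * w N j) (fun j => t j * l)
    (C * D) r r1) => [N j|j].
    by rewrite normrM mulrAC ler_pM.
  by apply: cvgM; [exact: cvg_cst|exact: wl].
have -> : series (fun j => t j * l) = (fun n => series t n * l).
  by apply/funext => n; rewrite /series /= mulr_suml.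
suff -> : lim ((fun n => series t n * l) @ \oo) = limn (series t) * l by [].
apply: cvg_lim; first exact: norm_hausdorff.
by apply: cvgM; [exact: ct|exact: cvg_cst].
Qed.

End ComplexSequences.

(** * Infinite products *)

Section QPochhammerBounds.
Context {R : realType}.
Implicit Types x p q : R[i].

Lemma subr1_neq0 x : `|x| < 1 -> 1 - x != 0.
Proof. by move=> x1; rewrite subr_eq0; apply: contraTneq x1 => <-;
  rewrite normr1 ltxx. Qed.

Lemma norm_mul_expr_lt1 x p n : `|x| < 1 -> `|p| < 1 -> `|x * p ^+ n| < 1.
Proof.
move=> x1 p1; rewrite normrM normrX (le_lt_trans _ x1)//.
by rewrite ler_piMr// exprn_ile1// ltW.
Qed.

Lemma qpoch_neq0 x p n : `|x| < 1 -> `|p| < 1 -> qpoch x p n != 0.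
Proof.
by move=> x1 p1; apply/prodf_neq0 => k _;
  rewrite subr1_neq0// norm_mul_expr_lt1.
Qed.

Lemma Re_norm_lt1 x : `|x| < 1 -> 0 <= Re `|x| < 1.
Proof. by move=> x1; rewrite -ler0c -ltcR Re_normK normr_ge0. Qed.

(** Each factor satisfies |1 - x p^k| <= 1 + |x| |p|^k <= exp(|x| |p|^k), and the exponents sum
    geometrically. *)
Lemma qpoch_bounded x p : `|p| < 1 ->
  exists C : R[i], forall n, `|qpoch x p n| <= C.
Proof.
move=> p1; have /geometric_sum_le r1 := Re_norm_lt1 p1.
set X := Re `|x|; set r := Re `|p| in r1.
have X0 : 0 <= X by rewrite -ler0c Re_normK.
exists (expR (X * (1 - r)^-1))%:C => n.
apply: (@le_trans _ _ (expR (X * \sum_(0 <= k < n) r ^+ k))%:C); last first.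
  by rewrite lecR ler_expR ler_wpM2l.
elim: n => [|n IHn]; first by rewrite qpoch0 big_nil mulr0 expR0 normr1.
rewrite qpochS normrM big_nat_recr //= mulrDr expRD rmorphM /= ler_pM //.
apply: (@le_trans _ _ (1 + X * r ^+ n)%:C); last by rewrite lecR expR_ge1Dx.
rewrite (le_trans (ler_normB _ _))// normr1 normrM normrX.
by rewrite rmorphD rmorphM rmorphXn /= !Re_normK.
Qed.

(** With X = |x| and y = X |p|^k <= X < 1, one has 1 / (1 - y) = 1 + y / (1 - y) <= 1 + y / (1 - X)
    <= exp(y / (1 - X)), and the exponents sum geometrically. *)
Lemma qpoch_inv_bounded x p : `|x| < 1 -> `|p| < 1 ->
  exists C : R[i], forall n, `|(qpoch x p n)^-1| <= C.
Proof.
move=> x1 p1; have /geometric_sum_le r1 := Re_norm_lt1 p1.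
have /andP[X0 X1] := Re_norm_lt1 x1; have /andP[r0 rlt1] := Re_norm_lt1 p1.
set X := Re `|x| in X0 X1; set r := Re `|p| in r0 rlt1 r1.
have D0 : 0 <= X / (1 - X) by rewrite divr_ge0 // subr_ge0 ltW.
exists (expR (X / (1 - X) * (1 - r)^-1))%:C => n.
apply: (@le_trans _ _ (expR (X / (1 - X) * \sum_(0 <= k < n) r ^+ k))%:C);
  last first.
  by rewrite lecR ler_expR ler_wpM2l.
elim: n => [|n IHn]; first by rewrite qpoch0 big_nil mulr0 expR0 invr1 normr1.
rewrite qpochS invfM normrM big_nat_recr //= mulrDr expRD rmorphM /= ler_pM //.
set y := X * r ^+ n.
have yX : y <= X by rewrite ler_piMr // exprn_ile1 // ltW.
have y1 : 0 < 1 - y by rewrite subr_gt0 (le_lt_trans yX).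
have y0 : 0 <= y by rewrite mulr_ge0 ?exprn_ge0.
apply: (@le_trans _ _ ((1 - y)^-1)%:C).
  have n0 : 0 < `|1 - x * p ^+ n|.
    by rewrite normr_gt0 subr1_neq0// norm_mul_expr_lt1.
  have yc0 : 0 < (1 - y)%:C by rewrite -[0]/(0%:C) ltcR.
  rewrite normfV fmorphV /= lef_pV2 //.
  rewrite rmorphB rmorph1 rmorphM rmorphXn /= !Re_normK -normrX -normrM.
  rewrite -[X in X - _](normr1 R[i]).
  exact: lerB_dist.
rewrite lecR (le_trans _ (expR_ge1Dx _))//.
have -> : (1 - y)^-1 = 1 + y / (1 - y) by field; rewrite gt_eqF.
rewrite lerD2l [leRHS]mulrAC -/y ler_wpM2l // lef_pV2 ?posrE ?subr_gt0 //.
  by rewrite lerD2l lerN2.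
exact: le_lt_trans X1.
Qed.

Lemma qpoch_cvgn x p : `|p| < 1 -> cvgn (qpoch x p).
Proof.
move=> p1; have [C qC] := qpoch_bounded x p1.
(* Consecutive products differ by -x p^k (x; p)_k, so the product is the partial sum of a series
   dominated geometrically. *)
have -> : qpoch x p = fun n => 1 + series (fun k => - x * p ^+ k
  * qpoch x p k) n.
  apply/funext => n; rewrite /series /=; elim: n => [|n IHn].
    by rewrite big_nil addr0 qpoch0.
  by rewrite big_nat_recr //= addrA -IHn qpochS; ring.
apply: is_cvgD; first exact: is_cvg_cst.
apply: (geometric_cvgn (C := `|x| * C) p1) => n.
rewrite !normrM normrN normrX mulrAC ler_wpM2r ?exprn_ge0//.
by rewrite ler_wpM2l.
Qed.

Lemma qpoch_cvg x p : `|p| < 1 -> qpoch x p @ \oo --> qpoch_inf x p.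
Proof. exact: qpoch_cvgn. Qed.

(** The bound C on the reciprocals keeps the moduli of the partial products at least 1 / C, so the
    limit cannot be 0. *)
Lemma qpoch_inf_neq0 x p : `|x| < 1 -> `|p| < 1 -> qpoch_inf x p != 0.
Proof.
move=> x1 p1; apply/eqP => q0; have := @qpoch_cvg x p p1; rewrite q0.
have [C qC] := qpoch_inv_bounded x1 p1.
have C0 : 0 < C by rewrite (lt_le_trans _ (qC 0))// qpoch0 invr1 normr1.
have iC0 : 0 < C^-1 by rewrite invr_gt0.
move=> /cvgr0Pnorm_lt/(_ _ iC0)[N _ /(_ N (leqnn N))] /= qN.
have := qC N; rewrite normfV -[leRHS]invrK lef_pV2 ?posrE ?normr_gt0
  ?qpoch_neq0//.
by move=> /le_lt_trans/(_ qN); rewrite ltxx.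
Qed.

Lemma qpochV_cvg x p : `|x| < 1 -> `|p| < 1 ->
  (fun n => (qpoch x p n)^-1) @ \oo --> (qpoch_inf x p)^-1.
Proof.
by move=> x1 p1; apply: cvgV; [exact: qpoch_inf_neq0|exact: qpoch_cvg].
Qed.

(** Reversing the sum gives j = n - i, and the total exponent 3n^2 + 2n - 2j^2 - j equals i + (3n^2
    + n - 2j^2), which is at least i because |j| <= n. Hence a geometric series dominates. *)
Lemma sym_sum_bounded q n : q != 0 -> `|q| < 1 ->
  `|q ^+ (3 * n ^ 2 + 2 * n) * sym_sum n (fun j => q ^ (- 2 * j ^+ 2 - j))|
    <= (1 - `|q|)^-1.
Proof.
move=> q0 q1; apply: (@le_trans _ _ (\sum_(0 <= k < n.*2.+1) `|q| ^+ k));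
  last first.
  by rewrite geometric_sum_le // normr_ge0.
rewrite /sym_sum mulr_sumr (le_trans (ler_norm_sum _ _ _))//.
rewrite big_mkord (reindex_inj rev_ord_inj) /=; apply: ler_sum => -[i /=];
  rewrite ltnS -addnn => le_i _.
rewrite subSS.
have [e ->] : exists e : nat, q ^+ (3 * n ^ 2 + 2 * n) *
    q ^ (- 2 * ((n + n - i)%N%:Z - n%:Z) ^+ 2 - ((n + n - i)%N%:Z - n%:Z))
      = q ^+ (i + e).
  set j := ((n + n - i)%N%:Z - n%:Z).
  have jE : j = n%:Z - i%:Z by rewrite /j; lia.
  have jn : (`|j| <= n)%N by rewrite jE; lia.
  have jj : j ^+ 2 = (`|j| ^ 2)%N%:Z by nia.
  have e0 : (2 * `|j| ^ 2 <= 3 * n ^ 2 + n)%N by nia.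
  exists (3 * n ^ 2 + n - 2 * `|j| ^ 2)%N.
  rewrite jj !exprnP -expfzDr //; congr (q ^ _); lia.
by rewrite normrX exprD ler_piMr ?exprn_ge0// exprn_ile1// ltW.
Qed.
End QPochhammerBounds.

(** * Passage to the limit *)

Section Assembly.
Context {R : realType}.
Variables q a b : R[i].
Hypotheses (q0 : q != 0) (a0 : a != 0) (b0 : b != 0) (q1 : `|q| < 1)
  (ab1 : `|a * b| < 1) (aq1 : `|a * q ^+ 2| < 1) (bq1 : `|b * q ^+ 2| < 1).

Let p1 : `|q ^+ 2| < 1.
Proof. by rewrite normrX exprn_ilt1. Qed.

Let q31 : `|q ^+ 3| < 1.
Proof. by rewrite normrX exprn_ilt1. Qed.

Let phi := phi32_term (q ^+ 2 / a) (q ^+ 2 / b) (q ^+ 2) 0 (q ^+ 3)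
  (q ^+ 2) (a * b).
Let rhs := rhs_term q a b.

Lemma qpoch_0l (p : R[i]) n : qpoch 0 p n = 1.
Proof. by rewrite /qpoch big1 // => i _; rewrite mul0r subr0. Qed.

Let phiE n : phi n = qpoch (q ^+ 2 / a) (q ^+ 2) n
  * qpoch (q ^+ 2 / b) (q ^+ 2) n
  * (qpoch (q ^+ 3) (q ^+ 2) n)^-1 * (a * b) ^+ n.
Proof.
rewrite /phi /phi32_term qpoch_0l; field.
by rewrite !qpoch_neq0.
Qed.

(** This is [bailey_lemma] with p = q^2, u = q^2/a, v = q^2/b and c = ab, so that cu = bq^2, cv =
    aq^2 and cuv = p^2. *)
Lemma finite_identity N :
  (1 - q)^-1 * \sum_(0 <= j < N.+1) phi j *
     (qpoch (a * b) (q ^+ 2) (N - j) / qpoch (q ^+ 2) (q ^+ 2) (N - j)) =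
  \sum_(0 <= r < N.+1) rhs r *
     (qpoch (a * q ^+ 2) (q ^+ 2) N * qpoch (b * q ^+ 2) (q ^+ 2) N
      / (qpoch (q ^+ 2) (q ^+ 2) (N - r) * qpoch (q ^+ 2) (q ^+ 2) (N + r).+1)).
Proof.
have eu : a * b * (q ^+ 2 / a) = b * q ^+ 2 by field.
have ev : a * b * (q ^+ 2 / b) = a * q ^+ 2 by field.
have euv : a * b * (q ^+ 2 / a) * (q ^+ 2 / b) = (q ^+ 2) ^+ 2.
  by field; rewrite a0 b0.
have hp n : qpoch (q ^+ 2) (q ^+ 2) n != 0 by rewrite qpoch_neq0.
have hq n : qpoch q (q ^+ 2) n != 0 by rewrite qpoch_neq0.
have ha n : qpoch (a * q ^+ 2) (q ^+ 2) n != 0 by rewrite qpoch_neq0.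
have hb n : qpoch (b * q ^+ 2) (q ^+ 2) n != 0 by rewrite qpoch_neq0.
have := @bailey_lemma R (bailey_alpha q) _ _ _ _ N euv hp.
rewrite eu ev => /(_ hb ha) E.
transitivity (\sum_(0 <= j < N.+1) qpoch (q ^+ 2 / a) (q ^+ 2) j *
  qpoch (q ^+ 2 / b) (q ^+ 2) j * (a * b) ^+ j *
  (qpoch (a * b) (q ^+ 2) (N - j) / qpoch (q ^+ 2) (q ^+ 2) (N - j)) *
  (\sum_(0 <= r < j.+1) bailey_alpha q r /
     (qpoch (q ^+ 2) (q ^+ 2) (j - r) * qpoch (q ^+ 2) (q ^+ 2) (j + r).+1))).
  rewrite mulr_sumr; apply: eq_bigr => j _.
  have -> := bailey_pair q0 hp hq j.
  (* The splitting (q; q^2)_{j+1} = (1 - q) (q^3; q^2)_j produces both the prefactor and the lower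
     parameter q^3. *)
  rewrite -[j.+1]add1n qpochD expr1 qpochS qpoch0 expr0 mulr1 mul1r -exprS phiE.
  have h3 : qpoch (q ^+ 3) (q ^+ 2) j != 0 by rewrite qpoch_neq0.
  by field; rewrite hp h3 subr1_neq0.
rewrite E; apply: eq_bigr => r _.
rewrite /rhs /rhs_term /bailey_alpha [(- (a * b)) ^+ r]exprNn.
by field; rewrite !hp ha hb.
Qed.

Lemma boundedM (f g : nat -> R[i]) :
    (exists C : R[i], forall n, `|f n| <= C) ->
      (exists C : R[i], forall n, `|g n| <= C) ->
  exists C : R[i], forall n, `|f n * g n| <= C.
Proof.
move=> [C fC] [D gD]; exists (C * D) => n.
by rewrite normrM ler_pM.
Qed.

Lemma phi_bounded : exists C : R[i], forall n, `|phi n| <= C * `|a * b| ^+ n.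
Proof.
have := boundedM (boundedM (qpoch_bounded (q ^+ 2 / a) p1)
  (qpoch_bounded (q ^+ 2 / b) p1)) (qpoch_inv_bounded q31 p1).
by move=> [C hC]; exists C => n;
  rewrite phiE normrM normrX ler_wpM2r ?exprn_ge0.
Qed.

(** The inner sum has terms with unbounded negative exponents, so it is bounded only together with
    [q ^+ (3 * n ^ 2 + 2 * n)]; the other factors are bounded separately. *)
Lemma rhs_bounded : exists C : R[i], forall n, `|rhs n| <= C * `|a * b| ^+ n.
Proof.
have bq : exists C : R[i], forall n, `|1 + q ^+ (2 * n + 1)| <= C.
  exists (1 + 1) => n; rewrite (le_trans (ler_normD _ _))// normr1 lerD2l
    normrX.
  by rewrite exprn_ile1 // ltW.
have bA : exists C : R[i], forall n, `|q ^+ (3 * n ^ 2 + 2 * n)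
    * sym_sum n (fun j => q ^ (- 2 * j ^+ 2 - j))| <= C.
  by exists (1 - `|q|)^-1 => n; exact: sym_sum_bounded.
have := boundedM (boundedM bq bA)
  (boundedM (boundedM (qpoch_bounded (q ^+ 2 / a) p1)
                      (qpoch_bounded (q ^+ 2 / b) p1))
    (boundedM (qpoch_inv_bounded aq1 p1) (qpoch_inv_bounded bq1 p1))).
move=> [C hC]; exists C => n.
rewrite -[`|a * b|]normrN -normrX (le_trans _
  (ler_wpM2r (normr_ge0 _) (hC n)))// -normrM.
rewrite /rhs /rhs_term le_eqVlt; apply/orP; left; apply/eqP; congr `|_|.
by field; rewrite !qpoch_neq0.
Qed.

Lemma phi32_rhs_identity :
  [/\ cvgn (series phi), cvgn (series rhs) &
      (qpoch_inf (q ^+ 2) (q ^+ 2) * qpoch_inf (a * b) (q ^+ 2))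
      / (qpoch_inf (a * q ^+ 2) (q ^+ 2) * qpoch_inf (b * q ^+ 2) (q ^+ 2))
      * limn (series phi) = (1 - q) * limn (series rhs)].
Proof.
have [C1 phiC] := phi_bounded; have [C2 rhsC] := rhs_bounded.
split; [exact: geometric_cvgn phiC|exact: geometric_cvgn rhsC|].
have [Cc cC] := qpoch_bounded (a * b) p1.
have [Cp pC] := qpoch_inv_bounded p1 p1.
have [Ca aC] := qpoch_bounded (a * q ^+ 2) p1.
have [Cb bC] := qpoch_bounded (b * q ^+ 2) p1.
have pV j : (fun N => (qpoch (q ^+ 2) (q ^+ 2) (N - j))^-1) @ \oo -->
    (qpoch_inf (q ^+ 2) (q ^+ 2))^-1.
  rewrite (cvg_centern j (fun N => (qpoch (q ^+ 2) (q ^+ 2) N)^-1)).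
  exact: qpochV_cvg.
have L : (fun N => \sum_(0 <= j < N.+1) phi j *
     (qpoch (a * b) (q ^+ 2) (N - j) / qpoch (q ^+ 2) (q ^+ 2) (N - j)))
     @ \oo -->
     limn (series phi)
     * (qpoch_inf (a * b) (q ^+ 2) / qpoch_inf (q ^+ 2) (q ^+ 2)).
  apply: (@weighted_tannery _ phi _ _ C1 (Cc * Cp) _ ab1 phiC) => [N j|j].
    by rewrite normrM ler_pM.
  apply: cvgM; last exact: pV.
  rewrite (cvg_centern j (qpoch (a * b) (q ^+ 2))).
  exact: qpoch_cvg.
have S : (fun N => \sum_(0 <= r < N.+1) rhs r *
     (qpoch (a * q ^+ 2) (q ^+ 2) N * qpoch (b * q ^+ 2) (q ^+ 2) N
      / (qpoch (q ^+ 2) (q ^+ 2) (N - r) * qpoch (q ^+ 2) (q ^+ 2) (N + r).+1)))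
      @ \oo --> limn (series rhs) *
     (qpoch_inf (a * q ^+ 2) (q ^+ 2) * qpoch_inf (b * q ^+ 2) (q ^+ 2)
      * ((qpoch_inf (q ^+ 2) (q ^+ 2))^-1 * (qpoch_inf (q ^+ 2) (q ^+ 2))^-1)).
  apply: (@weighted_tannery _ rhs _ _ C2 (Ca * Cb * (Cp * Cp))
    _ ab1 rhsC) => [N j|j].
    rewrite invfM !normrM ler_pM ?mulr_ge0 // ler_pM //.
  under eq_fun do rewrite invfM.
  apply: cvgM.
    by apply: cvgM; exact: qpoch_cvg.
  apply: cvgM; first exact: pV.
  rewrite (cvg_shiftn j (fun N => (qpoch (q ^+ 2) (q ^+ 2) N.+1)^-1)).
  rewrite (cvg_shiftS (fun N => (qpoch (q ^+ 2) (q ^+ 2) N)^-1)).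
  exact: qpochV_cvg.
have L' : (fun N => (1 - q)^-1 * \sum_(0 <= j < N.+1) phi j *
     (qpoch (a * b) (q ^+ 2) (N - j) / qpoch (q ^+ 2) (q ^+ 2) (N - j)))
     @ \oo -->
     (1 - q)^-1 * (limn (series phi)
       * (qpoch_inf (a * b) (q ^+ 2) / qpoch_inf (q ^+ 2) (q ^+ 2))).
  by apply: cvgM; [exact: cvg_cst|exact: L].
(* By [finite_identity] the sequences in [L'] and [S] coincide; uniqueness of limits equates their
   limits. *)
move: L'; under eq_fun do rewrite finite_identity.
move=> /(cvg_unique (@norm_hausdorff _ _))/(_ S)
  /(canRL (mulVKf (subr1_neq0 q1))) E.
(* [E] determines the series only after multiplication by (ab; q^2)_oo / (q^2; q^2)_oo, which is
   nonzero since |ab| < 1 and |q^2| < 1, and is divided out. *)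
rewrite -[limn (series phi)](mulfK
  (_ : qpoch_inf (a * b) (q ^+ 2) / qpoch_inf (q ^+ 2) (q ^+ 2) != 0)).
  by rewrite E; field; rewrite !qpoch_inf_neq0.
by rewrite mulf_neq0 ?invr_eq0 ?qpoch_inf_neq0.
Qed.

End Assembly.

Theorem theorem6p12 (R : realType) (q a b : R[i])
    (hq0 : q != 0) (ha0 : a != 0) (hb0 : b != 0) (hq : `|q| < 1)
    (hmax : Num.max `|a * b| (Num.max `|a * q ^+ 2| `|b * q ^+ 2|) < 1) :
  (* the infinite products and the two series converge, and the denominator
     is nonzero, so that both sides of the identity are meaningful *)
  [/\ forall x : R[i], cvgn (qpoch x (q ^+ 2)),
      qpoch_inf (a * q ^+ 2) (q ^+ 2) * qpoch_inf (b * q ^+ 2) (q ^+ 2) != 0,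
      cvgn (series (phi32_term (q ^+ 2 / a) (q ^+ 2 / b) (q ^+ 2)
                      0 (q ^+ 3) (q ^+ 2) (a * b))),
      cvgn (series (rhs_term q a b)) &
      (qpoch_inf (q ^+ 2) (q ^+ 2) * qpoch_inf (a * b) (q ^+ 2))
      / (qpoch_inf (a * q ^+ 2) (q ^+ 2) * qpoch_inf (b * q ^+ 2) (q ^+ 2))
      * phi32 (q ^+ 2 / a) (q ^+ 2 / b) (q ^+ 2) 0 (q ^+ 3) (q ^+ 2) (a * b)
      = (1 - q) * limn (series (rhs_term q a b))].
Proof.
(* Moduli are elements of [R[i]], which is only partially ordered; splitting each maximum requires
   its arguments to be comparable, as real elements are. *)
have hmax2 : (`|a * q ^+ 2| >=< `|b * q ^+ 2|)%R.
  by rewrite real_comparable ?normr_real.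
have := hmax; rewrite comparable_gt_max; last first.
  by rewrite real_comparable ?normr_real // /Order.max; case: ifP.
rewrite comparable_gt_max // => /and3P[ab1 aq1 bq1].
have p1 : `|q ^+ 2| < 1 by rewrite normrX exprn_ilt1.
have [cphi crhs E] := phi32_rhs_identity hq0 ha0 hb0 hq ab1 aq1 bq1.
split; [by move=> x; exact: qpoch_cvgn| |exact: cphi|exact: crhs|exact: E].
by rewrite mulf_neq0 ?qpoch_inf_neq0.
Qed.
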